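(* Let $n \ge 1$ be an integer and let $Z(n)$ be the number of terms in the Zeckendorf decomposition of $n$. The shortest possible play of the ordered Zeckendorf game on $n$ has length exactly $n - Z(n)$; that is, the minimum, over all plays from the initial state to a state with no legal move, of the number of moves made equals $n - Z(n)$.
   Context: The Fibonacci numbers are indexed by $F_1 = 1$, $F_2 = 2$, and $F_{i+1} = F_i + F_{i-1}$ for $i \ge 2$. The Zeckendorf decomposition of a positive integer $n$ is its unique representation as a sum of distinct, pairwise non-consecutive Fibonacci numbers $F_i$, $i \ge 1$ (non-consecutive means no two indices differ by 1). The (two-player) ordered Zeckendorf game on $n$: a state is a finite ordered list (tuple) of Fibonacci numbers. The initial state is the list $(F_1, F_1, \dots, F_1)$ of $n$ copies of $F_1$. Players alternate turns; on each turn the player performs one of the following legal moves on two adjacent entries of the list (the other entries and their order being unchanged): (1) Merging: replace an adjacent pair $(F_i, F_{i+1})$ with the single entry $F_{i+2}$. (2) Merging ones: replace an adjacent pair $(F_1, F_1)$ with the single entry $F_2$. (3) Splitting: replace an adjacent pair $(F_i, F_i)$ with $(F_{i-2}, F_{i+1})$, for $i > 2$. (4) Splitting twos: replace an adjacent pair $(F_2, F_2)$ with $(F_1, F_3)$. (5) Switching: replace an adjacent pair $(F_i, F_j)$ with $(F_j, F_i)$ whenever $i > j$. The game ends when no legal move can be applied. The length of a play is the total number of moves made (by both players together). *)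

(* Defs.v *)
From mathcomp Require Import all_boot zify.

Set Implicit Arguments.
Unset Strict Implicit.
Unset Printing Implicit Defensive.

(* F 1 = 1 and F 2 = 2. The value F 0 = 1 only makes the recurrence total: it
   is not one of the Fibonacci numbers of the game, and since F 0 = F 1 the
   bounds 1 <= i below matter. *)
Fixpoint F (i : nat) : nat :=
  match i with
  | 0 => 1
  | j.+1 => match j with 0 => 1 | k.+1 => F j + F k end
  end.

Arguments F : simpl never.

(* A decomposition is the list of its indices in decreasing order, so that it
   is unique as a list; j.+1 < i says that i and j are distinct and not
   consecutive. *)
Definition zeckendorf (n : nat) (s : seq nat) : bool :=
  [&& all (leq 1) s, pairwise (fun i j => j.+1 < i) s
    & \sum_(i <- s) F i == n].

Lemma F_recE (i : nat) : F i.+2 = F i.+1 + F i.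
Proof. by []. Qed.

Lemma F_gt0 (i : nat) : 0 < F i.
Proof.
suff: 0 < F i /\ 0 < F i.+1 by case.
by elim: i => // i [h1 h2]; split=> //; rewrite F_recE; lia.
Qed.

Lemma F_leq (i j : nat) : i <= j -> F i <= F j.
Proof.
move=> ij; rewrite -(subnKC ij); elim: (j - i) => [|k IHk]; first by rewrite addn0.
apply: (leq_trans IHk); rewrite addnS.
by case: (i + k) => // l; rewrite F_recE leq_addr.
Qed.

Lemma zeckendorf_exists (n : nat) : exists s, zeckendorf n s.
Proof.
pose P k := forall m, m < F k.+1 -> exists2 s, zeckendorf m s & all (geq k) s.
have P0 : P 0 by move=> [|m] // _; exists [::]; rewrite /zeckendorf ?big_nil.
have P1 : P 1.
  move=> [|[|m]] // _; first by exists [::]; rewrite /zeckendorf ?big_nil.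
  by exists [:: 1]; rewrite /zeckendorf ?big_seq1.
have PP k : P k /\ P k.+1.
  elim: k => [//|k [IH1 IH2]]; split=> // m; rewrite F_recE => hm.
  case: (ltnP m (F k.+2)) => [/IH2 [s zs ls]|hm'].
    by exists s => //; apply: sub_all ls => x /=; lia.
  have [|s /and3P [s1 s2 /eqP s3] ls] := IH1 (m - F k.+2); first lia.
  exists (k.+2 :: s); last by rewrite /= leqnn; apply: sub_all ls => x /=; lia.
  rewrite /zeckendorf big_cons s3 subnKC // eqxx /= s1 s2 !andbT.
  by apply: sub_all ls => x /=; lia.
have ltF k : k < F k.+1.
  elim: k => // k IHk; rewrite F_recE; have := F_gt0 k; lia.
by have [s zs _] := (PP n).1 n (ltF n); exists s.
Qed.

Lemma zeckendorf_lt (n k : nat) (s : seq nat) :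
  zeckendorf n (k :: s) -> F k <= n < F k.+1.
Proof.
elim: s k n => [|j s IHs] k n; rewrite /zeckendorf big_cons.
  case/and3P=> /= /andP [k1 _] _; rewrite big_nil addn0 => /eqP <-.
  by rewrite leqnn; case: k k1 => // k _; rewrite F_recE; have := F_gt0 k; lia.
case/and3P=> /= /andP [k1 s1] /andP [/andP [jk _] s2] /eqP <-.
have /IHs /andP [_] : zeckendorf (\sum_(i <- j :: s) F i) (j :: s).
  by rewrite /zeckendorf eqxx andbT /= s1 s2.
case: k k1 jk => [//|k] _ jk; rewrite F_recE leq_addr /= ltn_add2l => h.
by apply: (leq_trans h); apply: F_leq.
Qed.

Lemma zeckendorf_unique (n : nat) (s t : seq nat) :
  zeckendorf n s -> zeckendorf n t -> s = t.
Proof.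
have tl m k u : zeckendorf m (k :: u) -> zeckendorf (m - F k) u.
  rewrite /zeckendorf big_cons /=.
  by case/and3P=> /andP [_ ->] /andP [_ ->] /eqP <-; rewrite addKn eqxx.
have nz k u : ~ zeckendorf 0 (k :: u).
  by move/zeckendorf_lt => /andP [h _]; have := F_gt0 k; lia.
elim: s t n => [|i s IHs] [|j t] n //.
- by case/and3P=> _ _; rewrite big_nil => /eqP <- /nz.
- by move=> + /and3P [_ _]; rewrite big_nil => + /eqP h; rewrite -h => /nz.
move=> zs zt; have/andP [s1 s2] := zeckendorf_lt zs.
have/andP [t1 t2] := zeckendorf_lt zt.
have ij : i = j.
  by case: (ltngtP i j) => // /F_leq; lia.
by subst j; rewrite (IHs t _ (tl _ _ _ zs) (tl _ _ _ zt)).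
Qed.

Definition Z (n : nat) : nat := size (xchoose (zeckendorf_exists n)).

Lemma ZE (n : nat) (s : seq nat) : zeckendorf n s -> Z n = size s.
Proof. by move=> zs; rewrite /Z (zeckendorf_unique (xchooseP _) zs). Qed.

Lemma Z_leq (n : nat) : Z n <= n.
Proof.
have [s zs] := zeckendorf_exists n; rewrite (ZE zs).
case/and3P: zs => _ _ /eqP <-; elim: s => [|i s IHs]; first by rewrite big_nil.
by rewrite big_cons /=; have := F_gt0 i; lia.
Qed.

(* A state lists the Fibonacci numbers themselves, not their indices. *)
Definition state : Type := seq nat.

Definition initial (n : nat) : state := nseq n (F 1).

Inductive move : state -> state -> Prop :=
| Merge (u v : state) (i : nat) : 1 <= i ->
    move (u ++ [:: F i; F i.+1] ++ v) (u ++ [:: F i.+2] ++ v)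
| MergeOnes (u v : state) :
    move (u ++ [:: F 1; F 1] ++ v) (u ++ [:: F 2] ++ v)
| Split (u v : state) (i : nat) : 2 < i ->
    move (u ++ [:: F i; F i] ++ v) (u ++ [:: F (i - 2); F i.+1] ++ v)
| SplitTwos (u v : state) :
    move (u ++ [:: F 2; F 2] ++ v) (u ++ [:: F 1; F 3] ++ v)
| Switch (u v : state) (i j : nat) : 1 <= j -> j < i ->
    move (u ++ [:: F i; F j] ++ v) (u ++ [:: F j; F i] ++ v).

Definition terminal (s : state) : Prop := forall t, ~ move s t.

(* p lists the states reached after each successive move from s, so size p is
   the number of moves made by the two players together. Both players have the
   same legal moves, so whose turn it is need not be recorded. *)
Fixpoint complete_play (s : state) (p : seq state) : Prop :=
  if p is t :: p' then move s t /\ complete_play t p' else terminal s.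

(* Main.v *)
Require Import Defs.
From mathcomp Require Import all_boot zify.

(** Every move either keeps the number of entries or lowers it by one (the two
    merging moves), and every move keeps the sum of the entries. A state of
    Fibonacci numbers is terminal exactly when its indices increase by at least
    two from each entry to the next ([terminal_map_F]), that is, when read
    backwards it is a Zeckendorf decomposition of its sum. So every complete
    play goes from [n] entries to [Z n] entries, losing at most one per move,
    and takes at least [n - Z n] moves ([complete_play_lower_bound]).

    Equality holds if some complete play consists of merging moves only. Such a
    play exists because [F k] consecutive ones can be merged into the single
    entry [F k] ([merging_play_F]): build [F k] from the first [F k] ones of a
    block of [F k.+2] and [F k.+1] from the others, which puts the two entries
    in the order in which they may be merged. Cutting the initial state into
    blocks whose lengths are the Zeckendorf summands of [n] in increasing order
    and collapsing each block gives a terminal state. *)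

Set Implicit Arguments.
Unset Strict Implicit.
Unset Printing Implicit Defensive.

Definition gap (i j : nat) : bool := i.+1 < j.

Lemma F_ltn (i j : nat) : 0 < i -> i < j -> F i < F j.
Proof.
case: i => // i _ ij; apply: leq_trans (F_leq ij).
by rewrite F_recE -addn1 leq_add2l F_gt0.
Qed.

Lemma F_inj_pos (i j : nat) : 0 < i -> 0 < j -> F i = F j -> i = j.
Proof.
move=> i0 j0 Fij; case: (ltngtP i j) => // lt_ij.
  by have := F_ltn i0 lt_ij; rewrite Fij ltnn.
by have := F_ltn j0 lt_ij; rewrite Fij ltnn.
Qed.

(** The five kinds of move together cover exactly the adjacent pairs whose
    indices fail to be at distance at least two in increasing order. *)
Lemma move_at_non_gap (u v : state) (i j : nat) :
  0 < i -> 0 < j -> ~~ gap i j -> exists t, move (u ++ [:: F i; F j] ++ v) t.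
Proof.
move=> i0 j0; rewrite /gap -leqNgt leq_eqVlt ltnS.
case/predU1P=> [->|]; first by eexists; apply: Merge.
rewrite leq_eqVlt; case/predU1P=> [->|ji]; last by eexists; apply: Switch.
case: i i0 => [//|[|[|i]]] _.
- by eexists; apply: MergeOnes.
- by eexists; apply: SplitTwos.
- by eexists; apply: Defs.Split.
Qed.

Lemma move_non_gap (s t : state) : move s t ->
  exists u v i j,
    [/\ 0 < i, 0 < j, ~~ gap i j & s = u ++ [:: F i; F j] ++ v].
Proof.
case=> [u v i i0|u v|u v i i2|u v|u v i j j0 ji]; exists u, v.
- by exists i, i.+1; rewrite /gap; split=> //; lia.
- by exists 1, 1.
- by exists i, i; rewrite /gap; split=> //; lia.
- by exists 2, 2.
- by exists i, j; rewrite /gap; split=> //; lia.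
Qed.

Lemma move_cons (x : nat) (s t : state) : move s t -> move (x :: s) (x :: t).
Proof.
case=> [u v i i0|u v|u v i i2|u v|u v i j j0 ji]; rewrite -!(cat_cons x).
- exact: Merge.
- exact: MergeOnes.
- exact: Defs.Split.
- exact: SplitTwos.
- exact: Switch.
Qed.

Lemma sorted_gap_map_F (a : seq nat) (u v : state) (i j : nat) :
  all (leq 1) a -> sorted gap a -> 0 < i -> 0 < j ->
  map F a = u ++ [:: F i; F j] ++ v -> gap i j.
Proof.
move=> + + i0 j0; elim: u a => [|x u IHu] [|k a] //=.
  case: a => [|l a] //= /and3P [k0 l0 _] /andP [kl _] [Fk Fl _].
  by rewrite -(F_inj_pos k0 i0 Fk) -(F_inj_pos l0 j0 Fl).
by case/andP=> _ a0 /path_sorted sa [_ /(IHu _ a0 sa)].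
Qed.

Lemma terminal_map_F (a : seq nat) :
  all (leq 1) a -> terminal (map F a) <-> sorted gap a.
Proof.
move=> a0; split=> [|sa t /move_non_gap [u [v [i [j [i0 j0 /negP]]]]]]; last first.
  by move=> + e; apply; apply: sorted_gap_map_F e.
elim: a a0 => [//|i a IHa] /= /andP [i0 a0] ta.
have {}IHa : sorted gap a.
  by apply: IHa => // t /(move_cons (F i)); apply: ta.
case: a a0 ta IHa => [//|j a] /= /andP [j0 _] ta ->; rewrite andbT.
apply/negPn/negP=> /(move_at_non_gap [::] (map F a) i0 j0) [t].
exact: ta.
Qed.

Lemma sorted_gap_rev (a : seq nat) :
  sorted gap (rev a) = pairwise (fun i j => j.+1 < i) a.
Proof.
rewrite rev_sorted; apply: sorted_pairwise => j i k; rewrite /gap /=; lia.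
Qed.

Lemma zeckendorf_rev (a : seq nat) :
  all (leq 1) a -> sorted gap a -> zeckendorf (sumn (map F a)) (rev a).
Proof.
move=> a0 sa; rewrite /zeckendorf all_rev a0 -sorted_gap_rev revK sa /=.
by rewrite sumnE big_map (perm_big a) // perm_rev.
Qed.

Definition fibonacci_state (s : state) : Prop :=
  exists2 a, all (leq 1) a & s = map F a.

Lemma fibonacci_state_cat (s t : state) :
  fibonacci_state (s ++ t) <-> fibonacci_state s /\ fibonacci_state t.
Proof.
split=> [[a a0 e]|[[a a0 ->] [b b0 ->]]]; last first.
  by exists (a ++ b); rewrite ?map_cat // all_cat a0.
rewrite -(cat_take_drop (size s) a) all_cat in a0; case/andP: a0 => a0 b0.
split; [exists (take (size s) a)|exists (drop (size s) a)] => //.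
  by rewrite map_take -e take_size_cat.
by rewrite map_drop -e drop_size_cat.
Qed.

Lemma move_invariants (s t : state) : move s t ->
  [/\ size s <= (size t).+1, sumn t = sumn s
    & fibonacci_state s -> fibonacci_state t].
Proof.
have mid (u v : state) a b c : all (leq 1) c ->
    size (u ++ [:: F a; F b] ++ v) <= (size (u ++ map F c ++ v)).+1 ->
    sumn (map F c) = F a + F b ->
  [/\ size (u ++ [:: F a; F b] ++ v) <= (size (u ++ map F c ++ v)).+1,
      sumn (u ++ map F c ++ v) = sumn (u ++ [:: F a; F b] ++ v)
    & fibonacci_state (u ++ [:: F a; F b] ++ v) ->
      fibonacci_state (u ++ map F c ++ v)].
  move=> c0 hs hF; split=> //; first by rewrite !sumn_cat hF /= addn0.
  case/fibonacci_state_cat=> fu /fibonacci_state_cat [_ fv].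
  apply/fibonacci_state_cat; split=> //; apply/fibonacci_state_cat.
  by split=> //; exists c.
case=> [u v i i0|u v|u v i i2|u v|u v i j j0 ji].
- by apply: (mid u v _ _ [:: i.+2]); rewrite //= ?size_cat /= ?F_recE; lia.
- by apply: (mid u v _ _ [:: 2]); rewrite //= ?size_cat /=; lia.
- apply: (mid u v _ _ [:: i - 2; i.+1]); rewrite /= ?size_cat /=; try lia.
  case: i i2 => [|[|[|k]]] // _.
  by rewrite subSS subSS subn0 (F_recE k.+2) (F_recE k.+1); lia.
- by apply: (mid u v _ _ [:: 1; 3]); rewrite //= ?size_cat.
- by apply: (mid u v _ _ [:: j; i]); rewrite /= ?size_cat /=; lia.
Qed.

Lemma complete_play_lower_bound (s : state) (p : seq state) :
  fibonacci_state s -> complete_play s p -> size s <= size p + Z (sumn s).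
Proof.
elim: p s => [|t p IHp] s /= fs; last first.
  case=> /move_invariants [st <- ft] /(IHp _ (ft fs)); lia.
case: fs => a a0 -> /(terminal_map_F a0) sa.
by rewrite (ZE (zeckendorf_rev a0 sa)) size_rev size_map.
Qed.

(** When [z] is the number of entries at the end of [p], the equation says that
    every move of [p] is a merging one. Recording [z] instead of the number of
    moves lets the same [z] serve at each stage of the construction. *)
Definition merging_play (z : nat) (s : state) : Prop :=
  exists2 p, complete_play s p & size p + z = size s.

Lemma merging_play_move (z : nat) (s t : state) :
  move s t -> size s = (size t).+1 -> merging_play z t -> merging_play z s.
Proof.
move=> st hs [p tp hp]; exists (t :: p) => //.
by rewrite hs -hp.
Qed.

(** The context [u], [v] is arbitrary because the induction collapses the two
    halves of a block one inside the other's context. *)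
Lemma merging_play_F (z k : nat) (u v : state) : 0 < k ->
  merging_play z (u ++ F k :: v) -> merging_play z (u ++ nseq (F k) (F 1) ++ v).
Proof.
move=> k0; elim/ltn_ind: k k0 u v => -[|[|[|k]]] // IH _ u v.
  by apply: merging_play_move; [apply: MergeOnes | rewrite !size_cat /= !addnS].
move=> play; rewrite F_recE addnC nseqD -catA.
apply: (IH k.+1); rewrite // -cat_rcons.
apply: (IH k.+2); rewrite // cat_rcons.
by apply: merging_play_move play; [apply: Merge | rewrite !size_cat !addnS].
Qed.

Lemma merging_play_map_F (z : nat) (a : seq nat) (u : state) :
  all (leq 1) a -> merging_play z (u ++ map F a) ->
  merging_play z (u ++ nseq (sumn (map F a)) (F 1)).
Proof.
elim: a u => [//|k a IHa] u /= /andP [k0 a0] play.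
rewrite nseqD; apply: merging_play_F => //.
by rewrite -cat_rcons; apply: IHa; rewrite ?cat_rcons.
Qed.

Lemma merging_play_initial (n : nat) : merging_play (Z n) (initial n).
Proof.
have [s zs] := zeckendorf_exists n; rewrite (ZE zs).
case/and3P: zs => s0 gs /eqP <-.
have r0 : all (leq 1) (rev s) by rewrite all_rev.
have -> : \sum_(i <- s) F i = sumn (map F (rev s)).
  by rewrite sumnE big_map; apply: perm_big; rewrite perm_sym perm_rev.
apply: (merging_play_map_F (u := [::])) => //; exists [::].
  by apply/(terminal_map_F r0); rewrite sorted_gap_rev.
by rewrite size_map size_rev.
Qed.

Theorem proposition1p4 (n : nat) (n_ge1 : 1 <= n) :
  (exists p : seq state, complete_play (initial n) p /\ size p = n - Z n) /\
  (forall p : seq state, complete_play (initial n) p -> n - Z n <= size p).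
Proof.
split=> [|p play].
  have [p play] := merging_play_initial n; rewrite size_nseq => sizep.
  by exists p; split=> //; lia.
have fib : fibonacci_state (initial n).
  by exists (nseq n 1); rewrite ?map_nseq // all_nseq orbT.
have := complete_play_lower_bound fib play.
by rewrite sumn_nseq mul1n size_nseq; lia.
Qed.
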